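(* Let $A=\{a_1,\dots,a_n\}$ be a set of $n\ge 1$ distinct real numbers and let $l\in\{1,\dots,n\}$. Then $$\sum_{\substack{I\subset A\\ |I|<l}}(-1)^{|I|}\,\|I\|^k+\sum_{\substack{I\subset A\\ |I|=l}}(-1)^l\,\|I\|^k\,R_A(I)=\begin{cases}0, & k=0,1,\dots,n-1,\\[4pt] A!\displaystyle\sum_{i=0}^{l-1}(-1)^{n-i}\binom{n}{i}(l-i)^n, & k=n.\end{cases}$$
   Context: For a finite set $I$ of real numbers, $|I|$ is its cardinality and $\|I\|=\sum_{a\in I}a$ (so $\|\varnothing\|=0$); the convention $0^0=1$ is used, so $\|\varnothing\|^0=1$. $A!=\prod_{a\in A}a$. For $a\in A$, $R_A(a)=\prod_{b\in A\setminus\{a\}}\frac{b}{b-a}$, and for $I\subset A$, $R_A(I)=\sum_{a\in I}R_A(a)$. *)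

(* Defs.v *)
From mathcomp Require Import all_boot all_order all_algebra.
From mathcomp Require Import finmap reals.

Set Implicit Arguments.
Unset Strict Implicit.
Unset Printing Implicit Defensive.

Import GRing.Theory Num.Theory.
Local Open Scope ring_scope.
Local Open Scope fset_scope.

(* ||I|| *)
Definition set_sum (R : realType) (I : {fset R}) : R := \sum_(a <- I) a.

(* A! *)
Definition set_prod (R : realType) (A : {fset R}) : R := \prod_(a <- A) a.

(* R_A(a) *)
Definition RA (R : realType) (A : {fset R}) (a : R) : R :=
  \prod_(b <- A `\ a) (b / (b - a)).

(* R_A(I) *)
Definition RAset (R : realType) (A I : {fset R}) : R := \sum_(a <- I) RA A a.

(* 0 ^+ 0 = 1 in MathComp, so the empty set contributes 1 when k = 0. *)
Definition truncated_sum (R : realType) (A : {fset R}) (l k : nat) : R :=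
  \sum_(I <- fpowerset A | (#|` I| < l)%N) (-1) ^+ #|` I| * set_sum I ^+ k
  + \sum_(I <- fpowerset A | #|` I| == l) (-1) ^+ l * set_sum I ^+ k * RAset A I.

(* Main.v *)
Require Import Defs.
From mathcomp Require Import all_boot all_order all_algebra.
From mathcomp Require Import finmap reals ring.

(** The left-hand side only sees the subsets of [A] through the sums
    [f(||I||)], where [||I||] is the sum of the elements of [I] and
    [f = ^+ k].  Fix [a] in [A].  Splitting the subsets of size [i] according to whether
    they contain [a], and noting that [I |-> a |` I] replaces [||I||] by
    [||I|| + a], the alternating sum over [i < l] of
      [\sum_(|I| = i) f (||I|| + (l - i) a)]
    telescopes: only the subsets of size [l] that contain [a] survive
    ([alternating_sum_shift]).  Multiplying by [R_A(a)] and summing over [a]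
    turns the second sum of the theorem into one over subsets of size [< l], and
    the whole left-hand side becomes
      [\sum_(i < l) (-1)^i \sum_(|I| = i)
         ( p_I(0) - \sum_(a in A) p_I(a) R_A(a) )],
      where [p_I = (||I|| + (l - i) X)^k]
    ([truncated_sum_interpolation]).

    Now [R_A(a)] is the value at [0] of the Lagrange basis polynomial of the
    node [a], so the inner difference is the interpolation error at [0].  It
    vanishes when [deg p_I < n], and when [deg p_I = n] it is the leading
    coefficient times [\prod_(b in A) (0 - b) = (-1)^n A!]
    ([lagrange_at0]).  For [k = n] the leading coefficient is [(l - i)^n], which
    does not depend on [I], and there are [binomial n i] subsets [I]. *)

Set Implicit Arguments.
Unset Strict Implicit.
Unset Printing Implicit Defensive.

Import GRing.Theory.
Local Open Scope ring_scope.
Local Open Scope fset_scope.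

(** * Interpolation at zero *)

(** The product [\prod_(b != a) b / (b - a)] is the value at [0] of the Lagrange
    basis polynomial of [a].  A polynomial of degree at most [#|` A|] differs
    from its interpolant on [A] by its top coefficient times the monic
    polynomial vanishing on [A]. *)
Lemma lagrange_at0 (F : fieldType) (A : {fset F}) (p : {poly F}) :
  (size p <= #|` A|.+1)%N ->
  \sum_(a <- A) p.[a] * \prod_(b <- A `\ a) (b / (b - a)) =
    p.[0] - p`_#|` A| * ((-1) ^+ #|` A| * \prod_(b <- A) b).
Proof.
set n := #|` A| => size_p.
pose w := \prod_(b <- A) ('X - b%:P).
pose L a := \prod_(b <- A `\ a) (a - b)^-1 *: \prod_(b <- A `\ a) ('X - b%:P).
have size_w : size w = n.+1 by rewrite size_prod_XsubC.
have wn : w`_n = 1.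
  have /monicP := monic_prod_XsubC (enum_fset A) predT id.
  by rewrite lead_coefE -/w size_w.
have w_root c : c \in A -> w.[c] = 0.
  by move=> cA; rewrite /w (big_fsetD1 c) //= !hornerE subrr mul0r.
have size_L a : a \in A -> (size (L a) <= n)%N.
  move=> aA; rewrite (leq_trans (size_scale_leq _ _)) // size_prod_XsubC.
  by rewrite /n (cardfsD1 a A) aA.
have L_diag a : (L a).[a] = 1.
  rewrite hornerZ horner_prod -big_split /= big_seq big1 // => b.
  by rewrite !inE => /andP[neq_ba _]; rewrite !hornerE mulVf // subr_eq0 eq_sym.
have L_off a c : c \in A -> c != a -> (L a).[c] = 0.
  move=> cA neq_ca; rewrite hornerZ [X in _ * X.[c]](big_fsetD1 c) ?inE ?neq_ca //=.
  by rewrite hornerM hornerXsubC subrr mul0r mulr0.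
have L_0 a : (L a).[0] = \prod_(b <- A `\ a) (b / (b - a)).
  rewrite hornerZ horner_prod -big_split /=; apply: eq_bigr => b _.
  by rewrite !hornerE mulrN -mulNr -invrN opprB mulrC.
pose d := p - p`_n *: w - \sum_(a <- A) p.[a] *: L a.
have d0 : d = 0.
  apply: (@roots_geq_poly_eq0 _ _ (enum_fset A)).
    apply/allP => c cA; rewrite /root !hornerE horner_sum w_root //.
    rewrite (big_fsetD1 c) //= hornerZ L_diag big_seq big1 => [|a].
      by rewrite mulr0 mulr1 subr0 addr0 subrr.
    by rewrite !inE => /andP[neq_ac _]; rewrite hornerZ L_off ?mulr0 // eq_sym.
    exact: fset_uniq.
  (* subtracting [p`_n *: w] removes the coefficient of degree [n] *)
  apply/leq_sizeP => j; rewrite -/n => le_nj.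
  rewrite !coefB coef_sum big_seq big1 => [|a aA]; last first.
    by rewrite coefZ nth_default ?mulr0 // (leq_trans (size_L _ aA)).
  rewrite coefZ subr0; move: le_nj; rewrite leq_eqVlt => /predU1P[<-|lt_nj].
    by rewrite wn mulr1 subrr.
  have size_p_le : (size p <= j)%N := leq_trans size_p lt_nj.
  by rewrite [p`_j]nth_default // [w`_j]nth_default ?size_w // mulr0 subr0.
have w_0 : w.[0] = (-1) ^+ n * \prod_(b <- A) b.
  rewrite horner_prod; under eq_bigr do rewrite hornerXsubC sub0r -mulN1r.
  by rewrite big_split /= big_const_seq count_predT iter_mulr_1.
have := congr1 (horner^~ 0) d0.
rewrite hornerD hornerN hornerD hornerN hornerZ horner0 horner_sum w_0.
by move=> /subr0_eq ->; apply: eq_bigr => a _; rewrite hornerZ L_0.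
Qed.

(** Only an upper bound on the size holds, and the top coefficient below is not
    phrased with [lead_coef], because the degree drops when [d ^+ k = 0]. *)
Lemma size_affine_exp (R : nzRingType) (c d : R) (k : nat) :
  (size ((c%:P + d *: 'X) ^+ k) <= k.+1)%N.
Proof.
elim: k => [|k IHk]; first by rewrite expr0 size_poly1.
rewrite exprS (leq_trans (size_polyMleq _ _)) //.
have : (size (c%:P + d *: 'X)%R <= 2)%N.
  rewrite (leq_trans (size_polyD _ _)) // geq_max (leq_trans (size_polyC_leq1 _)) //.
  by rewrite (leq_trans (size_scale_leq _ _)) // size_polyX.
by move=> /leq_add /(_ IHk); case: addn.
Qed.

Lemma coef_affine_exp (R : nzRingType) (c d : R) (k : nat) :
  ((c%:P + d *: 'X) ^+ k)`_k = d ^+ k.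
Proof.
elim: k => [|k IHk]; first by rewrite !expr0 coef1.
rewrite !exprS mulrDl coefD coefCM -scalerAl coefZ coefXM /= IHk.
by rewrite nth_default ?mulr0 ?add0r // size_affine_exp.
Qed.

(** * Sums over the subsets of a given size *)

Lemma sum_card_lt (K : choiceType) (M : nmodType) (S : seq {fset K})
    (F : {fset K} -> M) (l : nat) :
  \sum_(I <- S | (#|` I| < l)%N) F I =
  \sum_(0 <= i < l) \sum_(I <- S | #|` I| == i) F I.
Proof.
rewrite big_mkcond /=.
under [RHS]eq_bigr do rewrite big_mkcond /=.
rewrite exchange_big /=; apply: eq_bigr => I _.
under [RHS]eq_bigr do rewrite eq_sym.
by rewrite -big_mkcond big_nat1_eq.
Qed.

Lemma count_subsets (K : choiceType) (A : {fset K}) (i : nat) :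
  (\sum_(I <- fpowerset A | #|` I| == i) 1)%N = 'C(#|` A|, i).
Proof.
rewrite cardfE -card_draws -sum1_card big_mkcond big_imfset /=; last first.
  move=> X Y _ _ /fsetP eqXY; apply/setP => x.
  by have := eqXY (val x); rewrite !inE.
rewrite -big_mkcond big_enum_cond; apply: eq_bigl => Y.
by rewrite !inE subsetT card_imfset -?cardE //; apply: val_inj.
Qed.

(** Inserting [a] is a bijection from the subsets avoiding [a] to those
    containing it. *)
Lemma sum_subsets_with (V : zmodType) (M : nmodType) (A : {fset V}) (a : V)
    (i : nat) (f : V -> M) : a \in A ->
  \sum_(I <- fpowerset A | (#|` I| == i.+1) && (a \in I)) f (\sum_(x <- I) x) =
  \sum_(I <- fpowerset A | (#|` I| == i) && (a \notin I)) f (\sum_(x <- I) x + a).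
Proof.
move=> aA; rewrite -big_filter -[RHS]big_filter.
rewrite (perm_big [seq a |` J | J <- [seq I <- fpowerset A |
  (#|` I| == i) && (a \notin I)]]) /=.
  rewrite big_map big_seq [RHS]big_seq; apply: eq_bigr => J.
  by rewrite mem_filter => /andP[/andP[_ aJ] _]; rewrite big_fsetU1 //= addrC.
apply: uniq_perm; first by rewrite filter_uniq ?fset_uniq.
  rewrite map_inj_in_uniq ?filter_uniq ?fset_uniq // => I J.
  rewrite !mem_filter => /andP[/andP[_ aI] _] /andP[/andP[_ aJ] _] eqIJ.
  by rewrite -(fsetU1K aI) eqIJ fsetU1K.
move=> I; rewrite mem_filter; apply/idP/mapP => [/andP[/andP[cI aI]]|[J]].
  rewrite fpowersetE => IA; exists (I `\ a); last by rewrite fsetD1K.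
  move: cI; rewrite mem_filter fpowersetE (cardfsD1 a) aI !inE eqxx /= eqSS.
  by move=> ->; rewrite (fsubset_trans (fsubsetDl _ _)).
rewrite mem_filter fpowersetE => /andP[/andP[cJ aJ] JA] ->.
by rewrite cardfsU1 aJ (eqP cJ) !inE eqxx fpowersetE fsubUset fsub1set aA JA eqxx.
Qed.

(** Write [g i] for the part of the [i]-th inner sum coming from the subsets that
    contain [a].  Exchanging one of the [l - i] shifts by [a] for the insertion
    of [a] into [I] shows that the part coming from the subsets avoiding [a] is
    [g i.+1].  So the sum of the [(-1)^i (g i + g i.+1)] telescopes, with
    [g 0 = 0] since the empty set does not contain [a]. *)
Lemma alternating_sum_shift (V : zmodType) (M : pzRingType) (A : {fset V})
    (a : V) (l : nat) (f : V -> M) : a \in A ->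
  \sum_(0 <= i < l) (-1) ^+ i *
    \sum_(I <- fpowerset A | #|` I| == i) f (\sum_(x <- I) x + a *+ (l - i)) =
  - ((-1) ^+ l *
     \sum_(I <- fpowerset A | (#|` I| == l) && (a \in I)) f (\sum_(x <- I) x)).
Proof.
move=> aA.
pose g i := \sum_(I <- fpowerset A | (#|` I| == i) && (a \in I))
  f (\sum_(x <- I) x + a *+ (l - i)).
have g0 : g 0%N = 0.
  rewrite /g big1 // => I /andP[]; rewrite cardfs_eq0 => /eqP ->.
  by rewrite inE.
rewrite (telescope_sumr_eq (fun i => - ((-1) ^+ i * g i))) //.
  rewrite g0 mulr0 oppr0 subr0 /g; congr (- (_ * _)).
  by apply: eq_bigr => I _; rewrite subnn mulr0n addr0.
move=> i /andP[_ lt_il]; rewrite exprS mulN1r mulNr !opprK -mulrDr; congr (_ * _).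
rewrite (bigID (fun I => a \in I)) /= addrC -/(g i).
rewrite [g i.+1](sum_subsets_with _ (fun x => f (x + a *+ (l - i.+1))%R)) //.
congr (_ + _)%R; apply: eq_bigr => I _.
by rewrite -addrA -mulrS subnSK.
Qed.

(** * The identity *)

Lemma sum_subset (K : choiceType) (M : nmodType) (A I : {fset K}) (F : K -> M) :
  I `<=` A -> \sum_(a <- I) F a = \sum_(a <- A | a \in I) F a.
Proof.
move=> IA; rewrite [RHS]big_fset_condE; apply: eq_fbigl => a.
by rewrite !inE /=; case: (boolP (a \in I)) => [/(fsubsetP IA) ->|]; rewrite ?andbF.
Qed.

(** In the terms with [#|` I| == l] of the left-hand side, [R_A(I)] is expanded
    into a sum over [a] in [A]; for each [a] this leaves the subsets of size [l]
    containing [a], which [alternating_sum_shift] trades for all the smaller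
    subsets. *)
Lemma truncated_sum_interpolation (R : realType) (A : {fset R}) (l k : nat) :
  truncated_sum A l k =
  \sum_(0 <= i < l) (-1) ^+ i * \sum_(I <- fpowerset A | #|` I| == i)
    (set_sum I ^+ k - \sum_(a <- A) (set_sum I + a *+ (l - i)) ^+ k * RA A a).
Proof.
rewrite /truncated_sum sum_card_lt.
under eq_bigr => i _.
  under eq_bigr => I /eqP-> do over.
  rewrite -mulr_sumr; over.
under [RHS]eq_bigr do rewrite sumrB mulrBr.
rewrite sumrB; congr (_ + _)%R.
transitivity (\sum_(a <- A) RA A a * ((-1) ^+ l *
   \sum_(I <- fpowerset A | (#|` I| == l) && (a \in I)) set_sum I ^+ k)).
  rewrite big_seq_cond.
  under eq_bigr => I /andP[].
    rewrite fpowersetE => IA _; rewrite /RAset (sum_subset _ IA) mulr_sumr.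
    rewrite big_mkcond; over.
  rewrite /= -big_seq_cond exchange_big /=; apply: eq_bigr => a _.
  rewrite [in RHS]big_mkcondr !mulr_sumr; apply: eq_bigr => I _.
  by case: ifP => _; rewrite ?mulr0 // mulrC.
rewrite big_seq.
under eq_bigr => a aA.
  rewrite -[(-1) ^+ l * _]opprK.
  rewrite -(alternating_sum_shift l (fun x => x ^+ k) aA) mulrN mulr_sumr; over.
rewrite sumrN -big_seq exchange_big /=; congr (- _); apply: eq_bigr => i _.
rewrite [in RHS]exchange_big /= [RHS]mulr_sumr; apply: eq_bigr => a _.
by rewrite mulrCA -mulr_suml [RA A a * _]mulrC.
Qed.

Theorem theorem1p6 (R : realType) (A : {fset R}) (n l : nat)
    (cardA : #|` A| = n) (n_ge1 : (1 <= n)%N) (l_bounds : (1 <= l <= n)%N) :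
  (forall k : nat, (k < n)%N -> truncated_sum A l k = 0) /\
  truncated_sum A l n =
    set_prod A *
      \sum_(0 <= i < l) (-1) ^+ (n - i) * 'C(n, i)%:R * (l%:R - i%:R) ^+ n.
Proof.
(* [set_sum I + a *+ (l - i)] is the value at [a] of an affine polynomial whose
   value at [0] is [set_sum I]. *)
pose p k i (I : {fset R}) : {poly R} :=
  ((set_sum I)%:P + (l - i)%:R *: 'X) ^+ k.
have error k i I : (k <= n)%N ->
    set_sum I ^+ k - \sum_(a <- A) (set_sum I + a *+ (l - i)) ^+ k * RA A a =
    (p k i I)`_n * ((-1) ^+ n * set_prod A).
  move=> le_kn.
  have size_p : (size (p k i I) <= #|` A|.+1)%N.
    by rewrite cardA (leq_trans (size_affine_exp _ _ _)).
  have eval a : (p k i I).[a] = (set_sum I + a *+ (l - i)) ^+ k.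
    by rewrite horner_exp hornerD hornerC hornerZ hornerX mulr_natl.
  under eq_bigr do rewrite -eval.
  by rewrite (lagrange_at0 size_p) cardA eval mul0rn addr0 subKr.
split=> [k lt_kn|].
  rewrite truncated_sum_interpolation big1 // => i _.
  rewrite big1 ?mulr0 // => I _; rewrite error 1?ltnW // nth_default ?mul0r //.
  by rewrite (leq_trans (size_affine_exp _ _ _)).
rewrite truncated_sum_interpolation mulr_sumr.
apply: eq_big_nat => i /andP[_ lt_il].
have le_in : (i <= n)%N by case/andP: l_bounds => _; apply/leq_trans/ltnW.
have sign : (-1) ^+ (n - i) = (-1) ^+ n * (-1) ^+ i :> R.
  by rewrite -[in RHS](subnK le_in) exprD -mulrA -expr2 sqrr_sign mulr1.
under eq_bigr => I _ do rewrite error // coef_affine_exp -[_ * _]mul1r.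
rewrite -mulr_suml -(natr_sum R _ _ (fun=> 1%N)) count_subsets cardA.
rewrite sign natrB 1?ltnW //.
by ring.
Qed.
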